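(* Suppose $\bar V\ge 0$. Consider the platform's problem when all users choose the high level of data sharing: $$\begin{aligned}\max_{I,p_0,p_1}\;& U(k,0)-B(I)F-I-p_1k-S\\ \text{s.t. }& p_1-\mathcal V\ge p_0-\alpha\mathcal V,\quad p_1-\mathcal V\ge 0,\quad I,p_0,p_1\ge 0,\end{aligned}$$ where $\mathcal V=\bar V+B(I)L$. Then optimal choices of the platform are as follows. 1. If $I_1$ exists, then $(I^*=I_1,\ p_1^*=\bar V+B(I_1)L,\ p_0^*=0)$ is optimal. 2. If $I_1$ does not exist, then $(I^*=0,\ p_1^*=\bar V+B(0)L,\ p_0^*=0)$ is optimal.
   Context: An online platform with $k\ge 1$ homogeneous users ($k$ an integer) chooses an investment $I\ge 0$ in data protection and data dividends $p_0,p_1\ge 0$ paid to each user for the low and high level of data sharing respectively. $B:[0,\infty)\to\mathbb{R}$ is twice differentiable with $B(I)>0$, $B'(I)<0$, $B''(I)>0$ for all $I$, and $\lim_{I\to\infty}B(I)=0$ ($B(I)$ is the probability of a data breach). $F>0$ is the platform's loss and $L>0$ each user's loss from a data breach; $S\in\mathbb{R}$ is a fixed cost; $U(k,b)\in\mathbb{R}$ is the platform's revenue when $b$ of the $k$ users choose the low level (so $U(k,0)$ is a constant here); $\alpha\in(0,1)$; $\bar V=V-W\in\mathbb{R}$, where $V$ is the value of a user's data and $W$ the value of the platform's free services. A user's expected utility is $p_1-\mathcal V$ at the high level and $p_0-\alpha\mathcal V$ at the low level, with $\mathcal V=\bar V+B(I)L$; the constraints of the problem say that the high level is utility-maximizing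 and gives nonnegative utility. Notation: $F_1=F+Lk$. $I_1=(B')^{-1}\left(-\frac1{F_1}\right)$ is the unique $I\ge0$ with $B'(I)=-1/F_1$; ''$I_1$ exists'' means that such a point in $[0,\infty)$ exists. ''Optimal'' means that the stated triple is an optimal solution (maximizer) of the problem. *)

(* Defs.v *)
From Stdlib Require Import Reals.
From Coquelicot Require Import Coquelicot.
Open Scope R_scope.

(* A function on [0, +oo) is represented by a total function R -> R of which
   only the values on [0, +oo) are constrained or used. *)
Definition halfline (x : R) : Prop := 0 <= x.

(* [D_in] is the derivative relative to a domain: two-sided at x > 0 and
   one-sided (from the right) at the end point 0. *)
Definition is_deriv_on_halfline (f f' : R -> R) : Prop :=
  forall x : R, halfline x -> D_in f f' halfline x.

(* [Vbar] is the value of a user's data minus the value of the free services;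
   [B I * L] is the user's expected loss from a data breach. *)
Definition calV (Vbar L : R) (B : R -> R) (I : R) : R := Vbar + B I * L.

Definition utility_high (Vbar L : R) (B : R -> R) (I p1 : R) : R :=
  p1 - calV Vbar L B I.

Definition utility_low (alpha Vbar L : R) (B : R -> R) (I p0 : R) : R :=
  p0 - alpha * calV Vbar L B I.

Definition profit (k : nat) (U : nat -> nat -> R) (F S : R) (B : R -> R)
    (I p1 : R) : R :=
  U k 0%nat - B I * F - I - p1 * INR k - S.

Definition feasible (alpha Vbar L : R) (B : R -> R) (I p0 p1 : R) : Prop :=
  utility_high Vbar L B I p1 >= utility_low alpha Vbar L B I p0 /\
  utility_high Vbar L B I p1 >= 0 /\
  I >= 0 /\ p0 >= 0 /\ p1 >= 0.

Definition optimal (k : nat) (U : nat -> nat -> R) (F S alpha Vbar L : R)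
    (B : R -> R) (I p0 p1 : R) : Prop :=
  feasible alpha Vbar L B I p0 p1 /\
  forall J q0 q1 : R, feasible alpha Vbar L B J q0 q1 ->
    profit k U F S B J q1 <= profit k U F S B I p1.

Definition F1 (k : nat) (F L : R) : R := F + L * INR k.

(* [B'] is injective on [0, +oo) when [B''] is positive, so at most one [I]
   satisfies this. *)
Definition is_I1 (k : nat) (F L : R) (B' : R -> R) (I : R) : Prop :=
  0 <= I /\ B' I = - (1 / F1 k F L).

(* Main.v *)
Require Import Defs.
From Stdlib Require Import Reals Lra.
From Coquelicot Require Import Coquelicot.
Open Scope R_scope.

(** For fixed [I] the cheapest feasible price is [p1 = Vbar + B I * L], so the
    problem reduces to minimizing [F1 * B I + I] over [I >= 0], i.e. to finding
    a point where a line of slope [- 1 / F1] supports the convex function [B]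
    from below. If [I1] exists, its tangent is such a line. Otherwise [B' + 1 / F1]
    has constant sign by the intermediate value theorem; it cannot be negative,
    as [B] would then become negative, so the line through [(0, B 0)] supports. *)

(* Constant continuation to the left of 0 turns one-sided continuity at 0 into
   the two-sided continuity that the library theorems ask for. *)
Definition extend (f : R -> R) (x : R) : R := f (Rmax 0 x).

Lemma extend_eq (f : R -> R) (x : R) : 0 <= x -> extend f x = f x.
Proof. intros Hx; unfold extend; now rewrite Rmax_right. Qed.

Lemma extend_continuity (f f' : R -> R) :
  is_deriv_on_halfline f f' -> Ranalysis1.continuity (extend f).
Proof.
  intros Hf x eps Heps.
  destruct (cont_deriv f f' halfline (Rmax 0 x) (Hf _ (Rmax_l 0 x)) eps Heps)
    as [d [Hd Hlim]].
  exists d; split; [exact Hd|].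
  intros y [_ Hy].
  unfold extend.
  (* The relative limit ignores the base point, so equal projections are treated apart; otherwise
     [Rmax 0] being 1-Lipschitz carries the bound over. *)
  destruct (Req_dec (Rmax 0 x) (Rmax 0 y)) as [E|E].
  - rewrite E; simpl; unfold Rdist.
    rewrite Rminus_diag, Rabs_R0; exact Heps.
  - apply Hlim; repeat split.
    + apply Rmax_l.
    + exact E.
    + revert Hy; simpl; unfold Rdist, Rmax, Rabs.
      destruct (Rle_dec 0 x), (Rle_dec 0 y);
        repeat destruct Rcase_abs; lra.
Qed.

Lemma extend_is_derive (f f' : R -> R) (x : R) :
  is_deriv_on_halfline f f' -> 0 < x -> is_derive (extend f) x (f' x).
Proof.
  intros Hf Hx.
  apply is_derive_Reals; intros eps Heps.
  destruct (Hf x (Rlt_le _ _ Hx) eps Heps) as [d [Hd Hlim]].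
  (* The bound by [x] keeps [x + h] inside the half-line. *)
  assert (Hm : 0 < Rmin d x) by (now apply Rmin_pos).
  exists (mkposreal _ Hm); simpl; intros h Hh0 Hh.
  assert (Hhd : Rabs h < d) by (eapply Rlt_le_trans; [exact Hh|apply Rmin_l]).
  assert (Hhx : Rabs h < x) by (eapply Rlt_le_trans; [exact Hh|apply Rmin_r]).
  apply Rabs_def2 in Hhx.
  rewrite !extend_eq by lra.
  specialize (Hlim (x + h)); simpl in Hlim; unfold Rdist, D_x, halfline in Hlim.
  replace (x + h - x) with h in Hlim by ring.
  apply Hlim; repeat split; lra.
Qed.

(** Interior points of the interval are positive, so two-sided derivatives suffice there. The
    endpoints are left unordered to serve both sides of a tangency point. *)
Lemma halfline_MVT (f f' : R -> R) (a b : R) :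
  is_deriv_on_halfline f f' -> 0 <= a -> 0 <= b ->
  exists c, Rmin a b <= c <= Rmax a b /\ f b - f a = f' c * (b - a).
Proof.
  intros Hf Ha Hb.
  destruct (MVT_gen (extend f) a b f') as [c [Hc E]].
  - intros x Hx; apply extend_is_derive; [exact Hf|].
    pose proof (Rmin_glb _ _ _ Ha Hb); lra.
  - intros x _; now apply (extend_continuity f f').
  - rewrite !extend_eq in E by assumption; now exists c.
Qed.

Lemma halfline_IVT (f f' : R -> R) (a b y : R) :
  is_deriv_on_halfline f f' -> 0 <= a -> 0 <= b -> f a <= y <= f b ->
  exists c, 0 <= c /\ f c = y.
Proof.
  intros Hf Ha Hb Hy.
  destruct (IVT_gen (extend f) a b y) as [c [Hc E]].
  - exact (extend_continuity f f' Hf).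
  - rewrite !extend_eq by assumption.
    rewrite Rmin_left, Rmax_right; lra.
  - pose proof (Rmin_glb _ _ _ Ha Hb).
    exists c; split; [lra|].
    rewrite <- E; symmetry; apply extend_eq; lra.
Qed.

Lemma halfline_increasing (f f' : R -> R) (a b : R) :
  is_deriv_on_halfline f f' -> (forall x, 0 <= x -> 0 < f' x) ->
  0 <= a <= b -> f a <= f b.
Proof.
  intros Hf Hpos Hab.
  destruct (halfline_MVT f f' a b Hf) as [c [Hc E]]; try lra.
  rewrite Rmin_left in Hc by lra.
  assert (0 <= f' c * (b - a)); [|lra].
  apply Rmult_le_pos; [|lra].
  apply Rlt_le, Hpos; lra.
Qed.

(** The chord from [a] to [x] has slope [f' c] for some [c] between them, and monotonicity of [f']
    compares it with [f' a]. *)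
Lemma halfline_tangent_below (f f' f'' : R -> R) (a x : R) :
  is_deriv_on_halfline f f' -> is_deriv_on_halfline f' f'' ->
  (forall y, 0 <= y -> 0 < f'' y) ->
  0 <= a -> 0 <= x -> f a + f' a * (x - a) <= f x.
Proof.
  intros Hf Hf' Hpos Ha Hx.
  destruct (halfline_MVT f f' a x Hf Ha Hx) as [c [Hc E]].
  destruct (Rle_dec a x) as [Hax|Hax].
  - rewrite Rmin_left, Rmax_right in Hc by lra.
    pose proof (halfline_increasing f' f'' a c Hf' Hpos ltac:(lra)).
    assert (f' a * (x - a) <= f' c * (x - a)); [|lra].
    apply Rmult_le_compat_r; lra.
  - rewrite Rmin_right, Rmax_left in Hc by lra.
    pose proof (halfline_increasing f' f'' c a Hf' Hpos ltac:(lra)).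
    (* Written with [a - x], which is nonnegative on this side. *)
    assert (f' c * (a - x) <= f' a * (a - x)); [|lra].
    apply Rmult_le_compat_r; lra.
Qed.

Lemma F1_pos (k : nat) (F L : R) : 0 < F -> 0 < L -> 0 < F1 k F L.
Proof.
  intros HF HL; unfold F1.
  pose proof (Rmult_le_pos L (INR k) (Rlt_le _ _ HL) (pos_INR k)); lra.
Qed.

Lemma optimal_of_supporting_line (k : nat) (U : nat -> nat -> R)
    (F L S alpha Vbar : R) (B : R -> R) (I : R) :
  0 < F -> 0 < L -> 0 <= alpha -> 0 <= Vbar ->
  (forall J, 0 <= J -> 0 <= B J) -> 0 <= I ->
  (forall J, 0 <= J -> B I - 1 / F1 k F L * (J - I) <= B J) ->
  optimal k U F S alpha Vbar L B I 0 (Vbar + B I * L).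
Proof.
  intros HF HL Halpha HVbar HB HI Hline.
  assert (HV : 0 <= Vbar + B I * L).
  { pose proof (Rmult_le_pos _ _ (HB I HI) (Rlt_le _ _ HL)); lra. }
  split.
  (* The high level yields exactly 0, and with [p0 = 0] the low level yields
     [- alpha * (Vbar + B I * L) <= 0]. *)
  - pose proof (Rmult_le_pos _ _ Halpha HV).
    unfold feasible, utility_high, utility_low, calV; repeat split; lra.
  - intros J q0 q1 (_ & Hq & HJ & _ & _).
    unfold utility_high, calV in Hq; unfold profit.
    assert (HF1 := F1_pos k F L HF HL).
    (* The dividends pass the users' expected losses on to the platform, so its total breach loss is
       [F1]; scaling the supporting line by [F1] compares total costs. *)
    assert (Hmin : F1 k F L * B I + I <= F1 k F L * B J + J).
    { pose proof (Rmult_le_compat_l _ _ _ (Rlt_le _ _ HF1)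
                    (Hline J (Rge_le _ _ HJ))) as H.
      replace (F1 k F L * (B I - 1 / F1 k F L * (J - I)))
        with (F1 k F L * B I - (J - I)) in H by (field; lra).
      lra. }
    assert (Hk : (Vbar + B J * L) * INR k <= q1 * INR k).
    { apply Rmult_le_compat_r; [apply pos_INR|lra]. }
    unfold F1 in Hmin; lra.
Qed.

Theorem mainTheorem6
  (k : nat) (U : nat -> nat -> R) (F L S alpha V W : R)
  (B B' B'' : R -> R)
  (hk : (1 <= k)%nat)
  (hF : 0 < F) (hL : 0 < L)
  (halpha : 0 < alpha < 1)
  (hB' : is_deriv_on_halfline B B')
  (hB'' : is_deriv_on_halfline B' B'')
  (hBpos : forall I : R, 0 <= I -> 0 < B I)
  (hB'neg : forall I : R, 0 <= I -> B' I < 0)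
  (hB''pos : forall I : R, 0 <= I -> 0 < B'' I)
  (hBlim : is_lim B p_infty 0)
  (hVbar : 0 <= V - W) :
  (forall I1 : R, is_I1 k F L B' I1 ->
     optimal k U F S alpha (V - W) L B I1 0 ((V - W) + B I1 * L)) /\
  ((~ exists I1 : R, is_I1 k F L B' I1) ->
     optimal k U F S alpha (V - W) L B 0 0 ((V - W) + B 0 * L)).
Proof.
  assert (HF1 := F1_pos k F L hF hL).
  assert (HB0 : forall J, 0 <= J -> 0 <= B J).
  { intros J HJ; now apply Rlt_le, hBpos. }
  split.
  - intros I1 [HI1 E].
    apply optimal_of_supporting_line; try assumption; [lra|].
    intros J HJ.
    pose proof (halfline_tangent_below B B' B'' I1 J hB' hB'' hB''pos HI1 HJ).
    rewrite E in H; lra.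
  - intros Hnone.
    apply optimal_of_supporting_line; try assumption; [lra|lra|].
    intros J HJ.
    destruct (Rle_dec (- (1 / F1 k F L)) (B' 0)) as [Hslope|Hslope].
    + pose proof (halfline_tangent_below B B' B'' 0 J hB' hB'' hB''pos
                    (Rle_refl 0) HJ).
      assert (- (1 / F1 k F L) * (J - 0) <= B' 0 * (J - 0)); [|lra].
      apply Rmult_le_compat_r; lra.
    + exfalso.
      (* A slope below [- 1 / F1] would bring [B] from [B 0] to 0 by this point. *)
      set (x := F1 k F L * B 0).
      assert (Hx : 0 < x).
      { apply Rmult_lt_0_compat; [exact HF1|apply hBpos; lra]. }
      destruct (halfline_MVT B B' 0 x hB') as [c [Hc E]]; try lra.
      rewrite Rmin_left in Hc by lra.
      (* If [B'] has risen to [- (1 / F1 k F L)] by [c], it takes that value in between,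
         contradicting [Hnone]; if not, [B x] falls below 0. *)
      destruct (Rle_dec (- (1 / F1 k F L)) (B' c)) as [Hsc|Hsc].
      * destruct (halfline_IVT B' B'' 0 c (- (1 / F1 k F L)) hB'')
          as [I1 HI1]; try lra.
        apply Hnone; now exists I1.
      * pose proof (hBpos x (Rlt_le _ _ Hx)).
        assert (Hd : B' c * (x - 0) <= - (1 / F1 k F L) * (x - 0)).
        { apply Rmult_le_compat_r; lra. }
        replace (- (1 / F1 k F L) * (x - 0)) with (- B 0) in Hd
          by (unfold x; field; lra).
        lra.
Qed.
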